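(* Let $X$ be a real normed space and let $C\subseteq X$ be a convex cone with a finite basis $\{e_1,e_2,\dots,e_n\}$. Then there exists $\eta>0$ such that for every sublinear correspondence $\varphi:C\rightarrow c(C)$ satisfying $\mathfrak{h}_1(M_{co(\varphi)},\{\mathbb{I}\})<\eta$, each matrix $A\in M_{\varphi}$ is invertible.
   Context: A subset $C$ of a real normed space $X$ is a cone if $tC\subseteq C$ for every $t>0$. A linearly independent set $E$ is a basis of the cone $C$ if $C$ is exactly the set of all finite combinations $\lambda_1e_1+\dots+\lambda_ne_n$ with $e_i\in E$ and $\lambda_i\ge 0$. $c(C)$ is the set of all nonempty compact subsets of $C$; $\varphi:C\to c(C)$ denotes a correspondence (set-valued map) with values $\varphi(x)\in c(C)$. It is sublinear if $\varphi(x+y)\subseteq\varphi(x)+\varphi(y)$ and $\varphi(\lambda x)=\lambda\varphi(x)$ for all $x,y\in C$, $\lambda>0$. $co(\varphi)$ is the correspondence $x\mapsto co(\varphi(x))$ (convex hull). The linear isomorphism $l:C-C\to\mathbb{R}^n$ is $l\left(\sum_{j=1}^n\lambda_je_j\right)=(\lambda_1,\dots,\lambda_n)^T$, and for a correspondence $\psi:C\twoheadrightarrow C$, $M_\psi:=l(\psi(e_1))\times\dots\times l(\psi(e_n))$ is regarded as the set of all real $n\times n$ matrices whose $j$-th column lies in $l(\psi(e_j))$ for each $j$. The space of real $n\times n$ matrices carries the norm $$\|A\|=\sup\left\{\left\|\sum_{i=1}^n\left(\sum_{j=1}^n\lambda_ja_{ij}\right)e_i\right\|:\ \sum_{j=1}^n\lambda_je_j\in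 C,\ \left\|\sum_{j=1}^n\lambda_je_j\right\|=1\right\},\quad A=[a_{ij}],$$ $\mathfrak{h}_1$ is the Hausdorff metric on nonempty compact sets of matrices derived from this norm, $\mathfrak{h}_1(P,Q)=\max\{\sup_{a\in P}d(a,Q),\sup_{b\in Q}d(b,P)\}$, and $\mathbb{I}$ is the unit (identity) matrix. *)

(* Defs.v *)
From HB Require Import structures.
From mathcomp Require Import all_boot all_order all_algebra.
From mathcomp Require Import all_classical all_reals all_analysis.
Import Order.TTheory GRing.Theory Num.Theory.
Import numFieldNormedType.Exports.

Set Implicit Arguments.
Unset Strict Implicit.
Unset Printing Implicit Defensive.

Local Open Scope classical_set_scope.
Local Open Scope ring_scope.

Definition is_cone (R : realType) (X : normedModType R) (C : set X) : Prop :=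
  forall t : R, 0 < t -> [set t *: x | x in C] `<=` C.

Definition lin_indep (R : realType) (X : normedModType R) (E : set X) : Prop :=
  forall (m : nat) (u : 'I_m -> X) (lam : 'I_m -> R),
    injective u -> (forall i, E (u i)) ->
    \sum_(i < m) lam i *: u i = 0 -> forall i, lam i = 0.

(* The empty combination (m = 0) is allowed, so the empty set is a basis of
   the cone {0}. *)
Definition is_cone_basis (R : realType) (X : normedModType R)
    (C E : set X) : Prop :=
  lin_indep E /\
  C = [set x | exists (m : nat) (u : 'I_m -> X) (lam : 'I_m -> R),
         [/\ forall i, E (u i), forall i, 0 <= lam i &
             x = \sum_(i < m) lam i *: u i]].

(* A correspondence on C is a total function X -> set X of which only the
   values at points of C are ever used. *)
Definition compact_corr (R : realType) (X : normedModType R)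
    (C : set X) (phi : X -> set X) : Prop :=
  forall x, C x -> [/\ phi x !=set0, compact (phi x) & phi x `<=` C].

Definition sublinear_corr (R : realType) (X : normedModType R)
    (C : set X) (phi : X -> set X) : Prop :=
  (forall x y, C x -> C y ->
     phi (x + y) `<=` [set a + b | a in phi x & b in phi y]) /\
  (forall (lam : R) x, 0 < lam -> C x ->
     phi (lam *: x) = [set lam *: a | a in phi x]).

Definition convex_hull (R : realType) (X : normedModType R)
    (A : set X) : set X :=
  smallest (fun B : set X => convex_set B) A.

Definition co_corr (R : realType) (X : normedModType R)
    (phi : X -> set X) : X -> set X := fun x => convex_hull (phi x).

Definition lincomb (R : realType) (X : normedModType R) (n : nat)
    (e : 'I_n -> X) (v : 'cV[R]_n) : X := \sum_(j < n) v j ord0 *: e j.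

(* The inverse of lincomb e on its range, which is C - C when range e is a
   basis of C; the value 0 outside that range is a dummy. *)
Definition coord_iso (R : realType) (X : normedModType R) (n : nat)
    (e : 'I_n -> X) (x : X) : 'cV[R]_n :=
  xget 0 [set v | lincomb e v = x].

Definition corr_mx (R : realType) (X : normedModType R) (n : nat)
    (e : 'I_n -> X) (psi : X -> set X) : set 'M[R]_n :=
  [set A | forall j, (coord_iso e @` psi (e j)) (col j A)].

(* The i-th coordinate of A *m lam is \sum_j A i j * lam j.  The set is bounded
   above when e is linearly independent, so the real-valued sup is the genuine
   supremum (except for n = 0, where it is sup set0 = 0). *)
Definition cone_mx_norm (R : realType) (X : normedModType R) (C : set X)
    (n : nat) (e : 'I_n -> X) (A : 'M[R]_n) : R :=
  sup [set `|lincomb e (A *m lam)| | lam in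
         [set lam : 'cV[R]_n | C (lincomb e lam) /\ `|lincomb e lam| = 1]].

Definition dist_to_set (R : realType) (n : nat) (N : 'M[R]_n -> R)
    (a : 'M[R]_n) (Q : set 'M[R]_n) : R :=
  inf [set N (a - b) | b in Q].

(* For nonempty compact P and Q the sups are over nonempty bounded sets. *)
Definition hausdorff_mx (R : realType) (n : nat) (N : 'M[R]_n -> R)
    (P Q : set 'M[R]_n) : R :=
  Num.max (sup [set dist_to_set N a Q | a in P])
          (sup [set dist_to_set N b P | b in Q]).

(* Main.v *)
Require Import Defs.
From mathcomp Require Import all_boot all_order all_algebra.
From mathcomp Require Import all_classical all_reals all_analysis.
Import Order.TTheory GRing.Theory Num.Theory.
Import numFieldNormedType.Exports.
Local Open Scope classical_set_scope.
Local Open Scope ring_scope.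

(** Write N for the norm of matrices given by the cone.  A matrix B with N(B) small
    cannot send a nonzero vector w to -w, hence 1 + B is invertible; applied to
    B = A - 1 this is the theorem.  Two estimates make it quantitative.

    Since e is free, there is c > 0 with c |w| <= |sum_j w_j e_j| for all w, where
    |w| is the largest modulus of a coordinate
    ([free_family_norm_lower_bound]): this is the equivalence of norms in finite
    dimension.  On the other hand e_j / |e_j| is a unit vector of the cone, so the
    j-th column of B represents a vector of norm at most |e_j| N(B)
    ([norm_lincomb_col_le]).  If A w = 0, then B w = -w, so

      c |w| <= |sum_j w_j e_j| = |sum_j (B w)_j e_j| <= |w| N(B) sum_j |e_j|,

    and w = 0 as soon as N(B) sum_j |e_j| < c ([near_identity_unitmx]).  The
    value eta = c / (1 + sum_j |e_j|) follows.

    It remains to see that the Hausdorff distance controls N(A - 1) for each A in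
    M_phi ([cone_mx_norm_le_hausdorff]).  As M_phi is contained in M_co(phi), the
    number N(A - 1) is one of those whose supremum enters the distance; but a real
    supremum only dominates its members when they are bounded.  The bound
    comes from compactness: the sets phi(e_j) are bounded, so are their convex
    hulls, and N(a - 1) is at most 1/c times the sum of the norms of the
    vectors represented by the columns of a - 1 ([cone_mx_norm_le]). *)

Lemma ler_coord_mx_norm {R : realType} {m n : nat} (x : 'M[R]_(m, n)) i j :
  `|x i j| <= `|x|.
Proof.
rewrite [leRHS]/Num.norm /= mx_normrE.
exact: (le_bigmax _ (fun ij : 'I_m * 'I_n => `|x ij.1 ij.2|) (i, j)).
Qed.

(** The function w |-> |sum_j w_j e_j| is continuous and, by freeness, positive on
    the compact unit sphere; c is its minimum there, and homogeneity extends the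
    bound to all w. *)
Lemma free_family_norm_lower_bound {R : realType} {X : normedModType R}
    {n : nat} (e : 'I_n -> X) :
  (forall w : 'rV[R]_n, \sum_j w ord0 j *: e j = 0 -> w = 0) ->
  exists2 c : R, 0 < c &
    forall w : 'rV[R]_n, c * `|w| <= `|\sum_j w ord0 j *: e j|.
Proof.
move=> e_free; pose g (w : 'rV[R]_n) := `|\sum_j w ord0 j *: e j|.
have gZ t w : g (t *: w) = `|t| * g w.
  rewrite /g -normrZ scaler_sumr; congr `|_|.
  by apply: eq_bigr => j _; rewrite mxE scalerA.
have g_cont : continuous g.
  move=> w; apply: (@cvg_comp _ _ _ _ Num.norm); last exact: norm_continuous.
  apply: cvg_big => [||j _]; [exact: add_continuous|exact: nbhs_filter|].
  apply: cvgZr_tmp; first exact: nbhs_filter.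
  exact: coord_continuous.
pose S := [set w : 'rV[R]_n | `|w| = 1].
have S_compact : compact S.
  apply: bounded_closed_compact.
    by exists 1; split=> // M M1 w /= ->; exact: ltW.
  apply: (@preimage_closed 'rV[R]_n R (fun w => `|w|) [set x | x = 1]);
    last exact: closed_eq.
  by move=> w _; exact: norm_continuous.
have S_normalize w : w != 0 -> S (`|w|^-1 *: w).
  by move=> w0; rewrite /S /= normrZ normfV normr_id mulVf // normr_eq0.
(* The sphere is empty exactly when n = 0, where any constant works. *)
have [[w0 Sw0]|S_empty] := pselect (S !=set0); last first.
  exists 1 => // w; have [->|/S_normalize Sw] := eqVneq w 0.
    by rewrite normr0 mulr0.
  by case: S_empty; exists (`|w|^-1 *: w).
have [||m /set_mem Sm m_min] := compact_EVT_min (f := g) _ S_compact _.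
- by exists w0.
- exact: continuous_subspaceT.
exists (g m) => [|w].
  rewrite normr_gt0; apply: contra_eq_neq Sm => /e_free ->.
  by rewrite normr0 eq_sym oner_neq0.
have [->|w_neq0] := eqVneq w 0; first by rewrite normr0 mulr0.
have := m_min _ (mem_set (S_normalize _ w_neq0)).
rewrite gZ normfV normr_id [in X in _ <= X]mulrC.
by rewrite ler_pdivlMr ?normr_gt0.
Qed.

(** The transpose in [c_lower] lets the bound come from
    [free_family_norm_lower_bound], where the coordinates form a row. *)
Section ConeMatrixNorm.
Context {R : realType} {X : normedModType R} (C : set X) {n : nat}
  {e : 'I_n -> X} {c : R}.
Hypothesis c_gt0 : 0 < c.
Hypothesis c_lower : forall v : 'cV[R]_n, c * `|v^T| <= `|lincomb e v|.

Lemma norm_lincomb_mulmx_le (B : 'M[R]_n) (v : 'cV[R]_n) :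
  `|lincomb e (B *m v)| <= `|v^T| * \sum_j `|lincomb e (col j B)|.
Proof.
have -> : lincomb e (B *m v) = \sum_j v j ord0 *: lincomb e (col j B).
  rewrite /lincomb; under [RHS]eq_bigr do rewrite scaler_sumr.
  rewrite exchange_big; apply: eq_bigr => i _ /=.
  rewrite mxE scaler_suml; apply: eq_bigr => j _.
  by rewrite mxE scalerA mulrC.
rewrite mulr_sumr; apply: le_trans (ler_norm_sum _ _ _) _.
apply: ler_sum => j _; rewrite normrZ ler_wpM2r //.
by have := ler_coord_mx_norm v^T ord0 j; rewrite mxE.
Qed.

(** A unit vector of the cone has coordinates of modulus at most 1/c, so the set
    whose supremum defines the norm is bounded; without this the real-valued
    supremum would carry no information. *)
Lemma cone_mx_norm_ubound (B : 'M[R]_n) :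
  ubound [set `|lincomb e (B *m lam)| | lam in
            [set lam : 'cV[R]_n | C (lincomb e lam) /\ `|lincomb e lam| = 1]]
    (c^-1 * \sum_j `|lincomb e (col j B)|).
Proof.
move=> _ [lam [_ lam1] <-]; apply: le_trans (norm_lincomb_mulmx_le _ _) _.
rewrite ler_wpM2r ?sumr_ge0 //.
by rewrite -[leRHS]mul1r ler_pdivlMr // mulrC -lam1.
Qed.

Lemma cone_mx_norm_le (B : 'M[R]_n) :
  cone_mx_norm C e B <= c^-1 * \sum_j `|lincomb e (col j B)|.
Proof.
rewrite /cone_mx_norm; set E := (X in sup X).
have [E0|E0] := pselect (E !=set0).
  exact: ge_sup E0 (cone_mx_norm_ubound B).
(* The supremum of the empty set is 0 by convention. *)
rewrite sup_out; last by case.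
by rewrite mulr_ge0 ?invr_ge0 ?sumr_ge0 // ltW.
Qed.

(** The j-th column of B is the image of the basis vector e_j, and e_j / |e_j| is
    among the unit vectors of the cone over which the norm of B is taken. *)
Lemma norm_lincomb_col_le (B : 'M[R]_n) j :
  (forall t, 0 <= t -> C (t *: e j)) -> e j != 0 ->
  `|lincomb e (col j B)| <= `|e j| * cone_mx_norm C e B.
Proof.
move=> C_ray ej0; have ej_gt0 : 0 < `|e j| by rewrite normr_gt0.
pose lam : 'cV[R]_n := `|e j|^-1 *: delta_mx j ord0.
have lamE : lincomb e lam = `|e j|^-1 *: e j.
  rewrite /lincomb (bigD1 j) //= big1 => [|i ij].
    by rewrite !mxE !eqxx mulr1 addr0.
  by rewrite !mxE (negPf ij) mulr0 scale0r.
have BlamE : lincomb e (B *m lam) = `|e j|^-1 *: lincomb e (col j B).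
  rewrite /lincomb scaler_sumr -scalemxAr -colE; apply: eq_bigr => i _.
  by rewrite mxE scalerA.
rewrite mulrC -ler_pdivrMr // mulrC.
apply: ub_le_sup; first by exists (c^-1 * \sum_j `|lincomb e (col j B)|);
  exact: cone_mx_norm_ubound.
exists lam; last by rewrite BlamE normrZ normfV normr_id.
split; rewrite lamE; first by apply: C_ray; rewrite invr_ge0.
by rewrite normrZ normfV normr_id mulVf // gt_eqF.
Qed.

(** A kernel vector w of A satisfies (A - 1) w = -w, and the two bounds on the norm
    of the vector with coordinates w are incompatible unless w = 0. *)
Lemma near_identity_unitmx (A : 'M[R]_n) :
  (forall j t, 0 <= t -> C (t *: e j)) -> (forall j, e j != 0) ->
  cone_mx_norm C e (A - 1%:M) * \sum_j `|e j| < c ->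
  A \in unitmx.
Proof.
move=> C_ray e_neq0 A_near; set B := A - 1%:M in A_near.
rewrite -unitmx_tr -row_free_unit -kermx_eq0; apply/rowV0P => w.
(* The kernel of A on columns is read off from the row kernel of A^T. *)
move/sub_kermxP/(congr1 trmx); rewrite trmx_mul trmxK trmx0 => Aw0.
apply/eqP; apply: contraTT A_near => w_neq0; rewrite -leNgt.
have wE : lincomb e (B *m w^T) = - lincomb e w^T.
  rewrite mulmxBl Aw0 mul1mx sub0r /lincomb -sumrN.
  by apply: eq_bigr => j _; rewrite mxE scaleNr.
have w_gt0 : 0 < `|w| by rewrite normr_gt0.
rewrite -(ler_pM2l w_gt0) mulrC -{1}[w]trmxK.
apply: le_trans (c_lower _) _.
rewrite -normrN -wE; apply: le_trans (norm_lincomb_mulmx_le _ _) _.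
rewrite trmxK ler_pM2l // mulr_sumr ler_sum // => j _.
by rewrite mulrC norm_lincomb_col_le // => t; exact: C_ray.
Qed.

End ConeMatrixNorm.

Lemma convex_closed_ball0 {R : realType} {X : normedModType R} (K : R) :
  convex_set [set x : X | `|x| <= K].
Proof.
apply/convex_setW => x y; rewrite !inE /= => xK yK t t0 t1.
have s0 : 0 <= 1 - t%:num by rewrite subr_ge0 ltW.
rewrite inE; change (`|t%:num *: (x : X) + (1 - t%:num) *: (y : X)| <= K).
apply: le_trans (ler_normD _ _) _.
rewrite !normrZ (ger0_norm (ltW t0)) (ger0_norm s0).
have -> : K = t%:num * K + (1 - t%:num) * K by rewrite -mulrDl subrKC mul1r.
by rewrite lerD // ler_wpM2l // ltW.
Qed.

Lemma convex_hull_norm_le {R : realType} {X : normedModType R}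
    (A : set X) (K : R) :
  (forall x, A x -> `|x| <= K) -> forall x, convex_hull A x -> `|x| <= K.
Proof. by move=> AK; apply: smallest_sub => //; exact: convex_closed_ball0. Qed.

(** Off the span of e the coordinates are 0 by convention, which is why this is only
    an inequality. *)
Lemma norm_lincomb_coord_iso_le {R : realType} {X : normedModType R}
    {n : nat} (e : 'I_n -> X) (x : X) :
  `|lincomb e (coord_iso e x)| <= `|x|.
Proof.
rewrite /coord_iso; case: xgetP => [v _ /= -> //|_].
by rewrite /lincomb big1 ?normr0 // => j _; rewrite mxE scale0r.
Qed.

Lemma lincomb_identity_col {R : realType} {X : normedModType R}
    {n : nat} (e : 'I_n -> X) j : lincomb e (col j 1%:M) = e j.
Proof.
rewrite /lincomb (bigD1 j) //= big1 => [|i ij].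
  by rewrite !mxE eqxx scale1r addr0.
by rewrite !mxE (negPf ij) scale0r.
Qed.

Lemma lincombB {R : realType} {X : normedModType R} {n : nat}
    (e : 'I_n -> X) (u v : 'cV[R]_n) :
  lincomb e (u - v) = lincomb e u - lincomb e v.
Proof.
rewrite /lincomb -sumrB; apply: eq_bigr => j _.
by rewrite !mxE scalerBl.
Qed.

(** The distance from A to the singleton of the identity is the norm of A - 1, a
    member of the family whose supremum is the first term of the Hausdorff
    distance; the bounds on the values of psi make this family bounded. *)
Lemma cone_mx_norm_le_hausdorff {R : realType} {X : normedModType R}
    (C : set X) {n : nat} (e : 'I_n -> X) (c : R) (psi : X -> set X)
    (A : 'M[R]_n) :
  0 < c -> (forall v : 'cV[R]_n, c * `|v^T| <= `|lincomb e v|) ->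
  (forall j, exists K, forall x, psi (e j) x -> `|x| <= K) ->
  corr_mx e psi A ->
  cone_mx_norm C e (A - 1%:M)
    <= hausdorff_mx (cone_mx_norm C e) (corr_mx e psi) [set 1%:M].
Proof.
move=> c_gt0 c_lower /choice [K psiK] MA.
have dist1 a : dist_to_set (cone_mx_norm C e) a [set 1%:M]
    = cone_mx_norm C e (a - 1%:M) by rewrite /dist_to_set image_set1 inf1.
rewrite /hausdorff_mx le_max; apply/orP; left.
apply: ub_le_sup; last by exists A => //; rewrite dist1.
exists (c^-1 * \sum_j (K j + `|e j|)) => _ [a Ma <-]; rewrite dist1.
apply: le_trans (cone_mx_norm_le C c_gt0 c_lower _) _.
rewrite ler_pM2l ?invr_gt0 // ler_sum // => j _.
rewrite linearB /= lincombB lincomb_identity_col.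
apply: le_trans (ler_normB _ _) _; rewrite lerD2r.
have [x psix <-] := Ma j.
exact: le_trans (norm_lincomb_coord_iso_le _ _) (psiK _ _ psix).
Qed.

Theorem corollary4 (R : realType) (X : normedModType R) (C : set X)
    (n : nat) (e : 'I_n -> X)
    (C_cone : is_cone C) (C_convex : convex_set C)
    (e_inj : injective e) (e_basis : is_cone_basis C (range e)) :
  exists2 eta : R, 0 < eta &
    forall phi : X -> set X,
      compact_corr C phi -> sublinear_corr C phi ->
      hausdorff_mx (cone_mx_norm C e) (corr_mx e (co_corr phi)) [set 1%:M]
        < eta ->
      forall A : 'M[R]_n, corr_mx e phi A -> A \in unitmx.
Proof.
case: e_basis => e_indep CE.
have C_ray j t : 0 <= t -> C (t *: e j).
  move=> t0; rewrite CE; exists 1%N, (fun=> e j), (fun=> t).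
  by split=> //; rewrite ?big_ord1 // => _; exists j.
have e_free (w : 'rV[R]_n) : \sum_j w ord0 j *: e j = 0 -> w = 0.
  move=> /(e_indep n e (w ord0) e_inj) w0; apply/rowP => j.
  by rewrite mxE w0 // => i; exists i.
have e_neq0 j : e j != 0.
  apply/eqP => ej0.
  have /e_free : \sum_i (delta_mx ord0 j : 'rV[R]_n) ord0 i *: e i = 0.
    apply: big1 => i _; rewrite mxE /=.
    by case: (eqVneq i j) => [->|_]; rewrite ?ej0 ?scaler0 ?scale0r.
  by move/rowP/(_ j)/eqP; rewrite !mxE !eqxx oner_eq0.
have [c c_gt0 c_rows] := free_family_norm_lower_bound e e_free.
have c_lower (v : 'cV[R]_n) : c * `|v^T| <= `|lincomb e v|.
  apply: le_trans (c_rows _) _; rewrite /lincomb.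
  by under eq_bigr do rewrite mxE.
have s_gt0 : 0 < 1 + \sum_j `|e j| by rewrite ltr_pwDl ?sumr_ge0.
exists (c / (1 + \sum_j `|e j|)) => [|phi phi_cpt _ phi_near A MA].
  exact: divr_gt0.
apply: (near_identity_unitmx C c_gt0) => //.
have phi_bnd j : exists K, forall x, co_corr phi (e j) x -> `|x| <= K.
  have Cej : C (e j) by rewrite -[e j]scale1r; exact: C_ray.
  have [_ /compact_bounded/pinfty_ex_gt0 [K _ phiK] _] := phi_cpt _ Cej.
  by exists K; exact: convex_hull_norm_le.
have MhullA : corr_mx e (co_corr phi) A.
  by move=> j; have [x phix <-] := MA j; exists x => //; exact: sub_gen_smallest.
have := cone_mx_norm_le_hausdorff C e c _ _ c_gt0 c_lower phi_bnd MhullA.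
move=> /le_lt_trans/(_ phi_near); rewrite ltr_pdivlMr //.
set N := cone_mx_norm _ _ _ => N_lt.
(* Multiplying by the sum alone instead of 1 plus the sum decreases the product
   only if N is nonnegative; for negative N the claim is trivial. *)
have [N_ge0|N_lt0] := leP 0 N.
  by apply: le_lt_trans N_lt; rewrite mulrDr mulr1 lerDr.
by rewrite (le_lt_trans _ c_gt0) // mulr_le0_ge0 ?sumr_ge0 // ltW.
Qed.
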